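(* Any SLOCC-maximal, symmetric state $|\Psi\rangle\in\mathbb C^2\otimes\mathbb C^2\otimes\mathbb C^2$ is a Frobenius state. It is SLOCC-equivalent to $|GHZ\rangle=|000\rangle+|111\rangle$ if and only if the associated commutative Frobenius algebra is special, and it is SLOCC-equivalent to $|W\rangle=|100\rangle+|010\rangle+|001\rangle$ if and only if the associated commutative Frobenius algebra is anti-special.
   Context: States are non-zero vectors; normalisation is ignored. For states in $H^{\otimes N}$: $|\Psi\rangle$ and $|\Phi\rangle$ are SLOCC-equivalent if $|\Psi\rangle=(L_1\otimes\cdots\otimes L_N)|\Phi\rangle$ for invertible linear $L_i:H\to H$; $|\Phi\rangle$ can be converted by SLOCC into $|\Psi\rangle$ if $|\Psi\rangle=(L_1\otimes\cdots\otimes L_N)|\Phi\rangle$ for some linear maps $L_i:H\to H$; $|\Psi\rangle$ is SLOCC-maximal if every state that can be converted into $|\Psi\rangle$ by SLOCC is SLOCC-equivalent to $|\Psi\rangle$. A state is symmetric if it is invariant under permutations of the tensor factors. An effect on $K$ is a linear functional $K\to\mathbb C$. A symmetric $|\Psi\rangle\in H^{\otimes3}$ is a Frobenius state if there exist effects $\langle\Phi|:H\otimes H\to\mathbb C$, $\langle\xi|:H\to\mathbb C$ such that (1) with $|\beta\rangle=(\langle\xi|\otimes1\otimes1)|\Psi\rangle$, $(1_H\otimes\langle\Phi|)(|\beta\rangle\otimes1_H)=1_H$; and (2) $(1\otimes1\otimes\langle\Phi|\otimes1\otimes1)(|\Psi\rangle\otimes|\Psi\rangle)\in H^{\otimes4}$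 is invariant under all permutations of the four factors. The associated (induced) commutative Frobenius algebra on $H$ of a Frobenius state $|\Psi\rangle$ with its effects $\langle\Phi|,\langle\xi|$ is $\delta=(1\otimes1\otimes\langle\Phi|)(|\Psi\rangle\otimes1)$, $\epsilon=\langle\xi|$, $\mu=(1\otimes\langle\Phi|)(\delta\otimes1)$, $\eta=(\langle\xi|\otimes\langle\xi|\otimes1)|\Psi\rangle$. (For a given state there may be several induced algebras, according to the choice of $\langle\xi|$; once $\langle\xi|$ is fixed, $\langle\Phi|$ is determined.) A commutative Frobenius algebra $(\mu,\eta,\delta,\epsilon)$ on a $D$-dimensional space $H$ with basis $|i\rangle$ and dual basis $\langle i|$ is special if $\mu\delta=1_H$, and anti-special if $D\cdot(\mu\circ\delta)=\ell\circ\ell'$, where $\ell=\sum_i(1\otimes\langle i|)\delta|i\rangle\in H$ and $\ell'=\sum_i\langle i|\,\mu(1\otimes|i\rangle)\in H^*$ are the partial traces of $\delta$ and $\mu$. *)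

(* Defs.v *)
From mathcomp Require Import all_boot all_order all_algebra all_fingroup.
From mathcomp Require Import reals complex.

Set Implicit Arguments.
Unset Strict Implicit.
Unset Printing Implicit Defensive.

Import GRing.Theory.
Local Open Scope ring_scope.

(* H is K^D with its standard basis, so that the product basis of the N-fold
   tensor power of H is indexed by {ffun 'I_N -> 'I_D}.  [thom K D m n] is the
   space of linear maps from the m-fold to the n-fold tensor power of H, given
   by their coefficients: f (y, x) is the coefficient of |y> in f|x>.  The
   0-fold power being K, vectors of the N-fold power are maps [thom K D 0 N]
   and effects on it are maps [thom K D N 0]. *)
Definition thom (K : fieldType) (D m n : nat) : Type :=
  {ffun {ffun 'I_n -> 'I_D} * {ffun 'I_m -> 'I_D} -> K}.

Declare Scope tensor_scope.
Delimit Scope tensor_scope with T.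

Section TensorPowers.
Context {K : fieldType} {D : nat}.
Local Notation thom := (thom K D).

Definition of_coef (m n : nat)
    (c : {ffun 'I_n -> 'I_D} -> {ffun 'I_m -> 'I_D} -> K) : thom m n :=
  [ffun p => c p.1 p.2].

Definition idm (n : nat) : thom n n := of_coef (fun y x => (y == x)%:R).

Definition tcomp (m n p : nat) (g : thom n p) (f : thom m n) : thom m p :=
  of_coef (fun z x => \sum_(y : {ffun 'I_n -> 'I_D}) g (z, y) * f (y, x)).

(* Sums of numerals reduce, so that for concrete arities the tensor product is
   strictly associative and unital at the level of types and no casts are
   needed. *)
Definition tens (m1 n1 m2 n2 : nat) (f : thom m1 n1) (g : thom m2 n2) :
    thom (m1 + m2) (n1 + n2) :=
  of_coef (fun y x =>
    f ([ffun i => y (lshift n2 i)], [ffun i => x (lshift m2 i)])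
    * g ([ffun i => y (rshift n1 i)], [ffun i => x (rshift m1 i)])).

Definition ket (i : 'I_D) : thom 0 1 := of_coef (fun y _ => (y ord0 == i)%:R).

Definition bra (i : 'I_D) : thom 1 0 := of_coef (fun _ x => (x ord0 == i)%:R).

Definition perm_map (n : nat) (s : 'S_n) : thom n n :=
  of_coef (fun y x => (y == [ffun i => x (s i)])%:R).

Definition tens_family (N : nat) (L : 'I_N -> 'M[K]_D) : thom N N :=
  of_coef (fun y x => \prod_(i < N) L i (y i) (x i)).

End TensorPowers.

Notation "g ∘ f" := (tcomp g f) (at level 40, left associativity) : tensor_scope.
Notation "f ⊗ g" := (tens f g) (at level 39, left associativity) : tensor_scope.
Local Open Scope tensor_scope.

Section SLOCC.
Context {K : fieldType} {D N : nat}.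

Definition symmetric_state (Psi : thom K D 0 N) : Prop :=
  forall s : 'S_N, perm_map s ∘ Psi = Psi.

Definition SLOCC_equivalent (Psi Phi : thom K D 0 N) : Prop :=
  exists2 L : 'I_N -> 'M[K]_D,
    (forall i, L i \in unitmx) & Psi = tens_family L ∘ Phi.

Definition SLOCC_convertible (Phi Psi : thom K D 0 N) : Prop :=
  exists L : 'I_N -> 'M[K]_D, Psi = tens_family L ∘ Phi.

Definition SLOCC_maximal (Psi : thom K D 0 N) : Prop :=
  forall Phi : thom K D 0 N,
    Phi != 0 -> SLOCC_convertible Phi Psi -> SLOCC_equivalent Phi Psi.

End SLOCC.

Definition GHZ_state (K : fieldType) : thom K 2 0 3 :=
  let k0 := ket (0 : 'I_2) in let k1 := ket (1 : 'I_2) in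
  (k0 ⊗ k0 ⊗ k0 : thom K 2 0 3) + (k1 ⊗ k1 ⊗ k1 : thom K 2 0 3).

Definition W_state (K : fieldType) : thom K 2 0 3 :=
  let k0 := ket (0 : 'I_2) in let k1 := ket (1 : 'I_2) in
  (k1 ⊗ k0 ⊗ k0 : thom K 2 0 3) + (k0 ⊗ k1 ⊗ k0 : thom K 2 0 3)
    + (k0 ⊗ k0 ⊗ k1 : thom K 2 0 3).

Record frobenius_data (K : fieldType) (D : nat) := FrobeniusData {
  fmul : thom K D 2 1;
  funit : thom K D 0 1;
  fcomul : thom K D 1 2;
  fcounit : thom K D 1 0
}.

Section Frobenius.
Context {K : fieldType} {D : nat}.
Local Notation thom := (thom K D).
Local Notation id1 := (@idm K D 1).

Definition swap : thom 2 2 := perm_map (tperm (0 : 'I_2) (1 : 'I_2)).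

Definition is_CFA (A : frobenius_data K D) : Prop :=
  let mu := fmul A in let eta := funit A in
  let delta := fcomul A in let eps := fcounit A in
  [/\ [/\ (mu ∘ (mu ⊗ id1) : thom 3 1) = mu ∘ (id1 ⊗ mu),
          (mu ∘ (eta ⊗ id1) : thom 1 1) = id1,
          (mu ∘ (id1 ⊗ eta) : thom 1 1) = id1
        & mu ∘ swap = mu],
      [/\ ((delta ⊗ id1) ∘ delta : thom 1 3) = (id1 ⊗ delta) ∘ delta,
          ((eps ⊗ id1) ∘ delta : thom 1 1) = id1,
          ((id1 ⊗ eps) ∘ delta : thom 1 1) = id1
        & swap ∘ delta = delta]
    & ((id1 ⊗ mu) ∘ (delta ⊗ id1) : thom 2 2) = delta ∘ mu /\
      ((mu ⊗ id1) ∘ (id1 ⊗ delta) : thom 2 2) = delta ∘ mu].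

(* Being special or anti-special is a property of commutative Frobenius
   algebras, hence the conjunct [is_CFA A] in both definitions. *)
Definition special (A : frobenius_data K D) : Prop :=
  is_CFA A /\ fmul A ∘ fcomul A = id1.

Definition comul_trace (delta : thom 1 2) : thom 0 1 :=
  \sum_(i < D) ((id1 ⊗ bra i : thom 2 1) ∘ delta ∘ ket i)%T.

Definition mul_trace (mu : thom 2 1) : thom 1 0 :=
  \sum_(i < D) (bra i ∘ mu ∘ (id1 ⊗ ket i : thom 1 2))%T.

Definition antispecial (A : frobenius_data K D) : Prop :=
  is_CFA A /\
  (fmul A ∘ fcomul A) *+ D = comul_trace (fcomul A) ∘ mul_trace (fmul A).

Definition frobenius_effects (Psi : thom 0 3) (Phi : thom 2 0) (xi : thom 1 0) :
    Prop :=
  let beta : thom 0 2 := (xi ⊗ id1 ⊗ id1) ∘ Psi in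
  ((id1 ⊗ Phi) ∘ (beta ⊗ id1) : thom 1 1) = id1 /\
  symmetric_state ((id1 ⊗ id1 ⊗ Phi ⊗ id1 ⊗ id1) ∘ (Psi ⊗ Psi) : thom 0 4).

Definition frobenius_state (Psi : thom 0 3) : Prop :=
  symmetric_state Psi /\
  exists (Phi : thom 2 0) (xi : thom 1 0), frobenius_effects Psi Phi xi.

Definition induced_algebra (Psi : thom 0 3) (Phi : thom 2 0) (xi : thom 1 0) :
    frobenius_data K D :=
  let delta : thom 1 2 := (id1 ⊗ id1 ⊗ Phi) ∘ (Psi ⊗ id1) in
  {| fmul := (id1 ⊗ Phi) ∘ (delta ⊗ id1);
     funit := (xi ⊗ xi ⊗ id1) ∘ Psi;
     fcomul := delta;
     fcounit := xi |}.

End Frobenius.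

(* Main.v *)
(* A symmetric three-qubit state is a binary cubic form with coefficients w0, ..., w3, w_k
   being the coefficient of the basis vectors with k ones.  For an effect xi = (x, y), the
   matrix of (xi ⊗ 1 ⊗ 1) Psi has as determinant D the Hessian of the cubic at xi; condition
   (1) on the effects says that D is nonzero and that Phi is the inverse matrix, and then
   condition (2) holds automatically.  The Hessian vanishes only for product states, which
   are not maximal because GHZ converts into them.  For the induced algebra,
     2 (mu ∘ delta) - l ∘ l' = disc / D^3 * (J xi) ⊗ (J eta)   with J (a, b) = (b, -a),
   so that the algebra is anti-special exactly when the discriminant vanishes, and not
   special in that case.  Finally the Hessian coefficients give a linear recurrence for w:
   if disc <> 0, its two distinct roots write the state as u u u + v v v (GHZ), and the
   effect with xi u = xi v = 1 makes the algebra special; if disc = 0, its double root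
   writes the state as e v v + v e v + v v e (W).  Conversely, disc is Cayley's
   hyperdeterminant, whose vanishing is invariant under SLOCC. *)
Require Import Defs.
From mathcomp Require Import all_boot fingroup perm all_algebra ring.
From mathcomp Require Import reals complex.
From mathcomp Require boolp.
Set Implicit Arguments.
Unset Strict Implicit.
Unset Printing Implicit Defensive.
Import GRing.Theory Num.Theory.
Local Open Scope ring_scope.
Local Open Scope tensor_scope.

(** * Bit words as indices of the product basis *)

Definition bit (b : bool) : 'I_2 := if b then 1 else 0.

Lemma bit_inj : injective bit. Proof. by case; case. Qed.

Definition word n (s : seq bool) : {ffun 'I_n -> 'I_2} :=
  [ffun i : 'I_n => bit (nth false s i)].

(** A boolean equality that reduces on concrete words once [eqw], [negb] and [andb] are unfolded. *)
Fixpoint eqw (s t : seq bool) : bool :=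
  match s, t with
  | [::], [::] => true
  | b :: s', c :: t' => (if b then c else ~~ c) && eqw s' t'
  | _, _ => false
  end.

Lemma eqwE s t : eqw s t = (s == t).
Proof. by elim: s t => [|[] s IH] [|[] t] //=; rewrite IH. Qed.

Lemma word_onto n (y : {ffun 'I_n -> 'I_2}) :
  exists2 s, size s = n & y = word n s.
Proof.
exists [seq (val (y i) == 1)%N | i <- enum 'I_n].
  by rewrite size_map size_enum_ord.
apply/ffunP=> i; rewrite ffunE (nth_map i) ?size_enum_ord // nth_ord_enum.
by case: (y i) => -[|[|]] // k; apply/val_inj.
Qed.

Lemma word_inj n s t : size s = n -> size t = n -> word n s = word n t -> s = t.
Proof.
move=> ss st /ffunP h; apply: (@eq_from_nth _ false); first by rewrite ss st.
by move=> i; rewrite ss => lin; apply: bit_inj; have := h (Ordinal lin); rewrite !ffunE.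
Qed.

Section Sums.
Context {V : nmodType}.

(** At a concrete [n] this unfolds to an explicit sum of [2 ^ n] terms, a form accepted by [ring]
    and [field]. *)
Fixpoint sum_words n (F : seq bool -> V) : V :=
  if n is n'.+1 then sum_words n' (fun s => F (false :: s)) +
                     sum_words n' (fun s => F (true :: s))
  else F [::].

Lemma eq_sum_words n F G :
  (forall s, size s = n -> F s = G s) -> sum_words n F = sum_words n G.
Proof.
elim: n F G => [|n IH] F G eFG /=; first exact: eFG.
by congr (_ + _); apply: IH => s ss; apply: eFG; rewrite /= ss.
Qed.

Lemma sum_word n (F : {ffun 'I_n -> 'I_2} -> V) :
  \sum_y F y = sum_words n (fun s => F (word n s)).
Proof.
elim: n F => [|n IH] F /=.
  rewrite (big_pred1 (word 0 [::])) // => y.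
  by symmetry; apply/eqP/ffunP; case.
rewrite (bigID (fun y : {ffun _} => y ord0 == bit false)) /=.
(* Words with first letter [b] are reindexed by their tails: [h] prepends [b], [g] drops the first
   letter. *)
have tl (b : bool) : \sum_(y : {ffun 'I_n.+1 -> 'I_2} | y ord0 == bit b) F y =
   sum_words n (fun s => F (word n.+1 (b :: s))).
  pose h (z : {ffun 'I_n -> 'I_2}) : {ffun 'I_n.+1 -> 'I_2} :=
    [ffun i => if unlift ord0 i is Some j then z j else bit b].
  pose g (y : {ffun 'I_n.+1 -> 'I_2}) : {ffun 'I_n -> 'I_2} :=
    [ffun j => y (lift ord0 j)].
  rewrite (reindex_onto h g) /=; last first.
    move=> y /eqP yb; apply/ffunP=> i; rewrite !ffunE.
    by case: unliftP => [j|] ->; rewrite ?ffunE ?yb.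
  rewrite (eq_bigl xpredT); last first.
    move=> z; rewrite ffunE unlift_none eqxx; apply/eqP/ffunP=> j.
    by rewrite !ffunE liftK.
  rewrite IH; apply: eq_sum_words => s _; congr F; apply/ffunP=> i; rewrite !ffunE.
  by case: unliftP => [j|] -> //=; rewrite ffunE.
congr (_ + _); first exact: (tl false).
rewrite -(tl true); apply: eq_bigl => y.
by case: (y ord0) => -[|[|]].
Qed.

End Sums.

(** * Coefficients of tensor maps, and symmetric states as binary forms *)

Section Coef.
Context {K : fieldType}.
Local Notation thom := (thom K 2).

Definition coef m n (f : thom m n) (ys xs : seq bool) : K :=
  f (word n ys, word m xs).

Fixpoint all_words n (P : seq bool -> Prop) : Prop :=
  if n is n'.+1 then all_words n' (fun s => P (false :: s)) /\
                     all_words n' (fun s => P (true :: s))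
  else P [::].

Lemma all_wordsP n P : all_words n P <-> forall s, size s = n -> P s.
Proof.
split; elim: n P => [|n IH] P /=.
- by move=> P0 [].
- by case=> /IH h0 /IH h1 [//|[] s] [ss]; [apply: h1|apply: h0].
- by apply.
- by move=> h; split; apply: IH => s ss; apply: h; rewrite /= ss.
Qed.

(* The arities in [sem f F] are compared up to conversion, whereas rewriting with
   equations about [coef] would have to unify them syntactically. *)
Definition sem m n (f : thom m n) (F : seq bool -> seq bool -> K) : Prop :=
  forall ys xs, size ys = n -> size xs = m -> coef f ys xs = F ys xs.

Lemma sem_coef m n (f : thom m n) : sem f (coef f).
Proof. by []. Qed.

(** At concrete arities [all_words] unfolds to a conjunction, so a diagrammatic identity becomes one
    scalar equation for each pair of basis words. *)
Lemma sem_eqP m n (f g : thom m n) F G : sem f F -> sem g G ->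
  f = g <-> all_words n (fun ys => all_words m (fun xs => F ys xs = G ys xs)).
Proof.
move=> sf sg; split=> [efg|/all_wordsP h].
  by apply/all_wordsP=> ys sy; apply/all_wordsP=> xs sx; rewrite -sf // -sg // efg.
apply/ffunP=> -[y x]; have [ys sy ->] := word_onto y; have [xs sx ->] := word_onto x.
have /all_wordsP/(_ xs sx) := h ys sy.
by rewrite -sf // -sg.
Qed.

Lemma sem_tcomp m n p (g : thom n p) (f : thom m n) G F : sem g G -> sem f F ->
  sem (g ∘ f) (fun zs xs => sum_words n (fun ys => G zs ys * F ys xs)).
Proof.
move=> sg sf zs xs sz sx; rewrite /coef ffunE /= sum_word.
by apply: eq_sum_words => ys sy; rewrite -sg // -sf.
Qed.

Lemma sem_tens m1 n1 m2 n2 (f : thom m1 n1) (g : thom m2 n2) F G :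
  sem f F -> sem g G ->
  sem (f ⊗ g) (fun ys xs => F (take n1 ys) (take m1 xs) * G (drop n1 ys) (drop m1 xs)).
Proof.
move=> sf sg ys xs sy sx.
have wt k l s : [ffun i => word (k + l) s (lshift l i)] = word k (take k s).
  by apply/ffunP=> i; rewrite !ffunE /= nth_take.
have wd k l s : [ffun i => word (k + l) s (rshift k i)] = word l (drop k s).
  by apply/ffunP=> i; rewrite !ffunE /= nth_drop.
rewrite /coef ffunE /= !wt !wd; congr (_ * _); [apply: sf|apply: sg].
- by rewrite size_takel // sy leq_addr.
- by rewrite size_takel // sx leq_addr.
- by rewrite size_drop sy addKn.
- by rewrite size_drop sx addKn.
Qed.

Lemma sem_idm n : sem (idm n) (fun ys xs => (eqw ys xs)%:R).
Proof.
move=> ys xs sy sx; rewrite /coef ffunE /= eqwE; congr (nat_of_bool _)%:R.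
by apply/eqP/eqP=> [/word_inj|->] //; apply.
Qed.

Lemma sem_bra b : sem (bra (bit b)) (fun _ xs => (eqw xs [:: b])%:R).
Proof. by move=> [] // [|c []] // _ _; rewrite /coef ffunE /= ffunE; case: b; case: c. Qed.

Lemma sem_ket b : sem (ket (bit b)) (fun ys _ => (eqw ys [:: b])%:R).
Proof. by move=> [|c []] // [] // _ _; rewrite /coef ffunE /= ffunE; case: b; case: c. Qed.

Lemma sem_swap : sem swap (fun ys xs => (eqw ys (rev xs))%:R).
Proof.
move=> [|b [|c []]] // [|b' [|c' []]] // _ _.
rewrite -(@sem_idm 2) //; rewrite /coef !ffunE /=; congr (nat_of_bool (_ == _))%:R.
apply/ffunP=> i; rewrite !ffunE.
have [->|->] : i = 0 \/ i = 1 by case: i => -[|[|]] // k; [left|right]; apply/val_inj.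
  by rewrite tpermL.
by rewrite tpermR.
Qed.

Lemma sem_add m n (f g : thom m n) F G :
  sem f F -> sem g G -> sem (f + g) (fun ys xs => F ys xs + G ys xs).
Proof. by move=> sf sg ys xs sy sx; rewrite /coef ffunE -sf // -sg. Qed.

Lemma sem_mulrn m n (f : thom m n) k F :
  sem f F -> sem (f *+ k) (fun ys xs => F ys xs *+ k).
Proof.
move=> sf; elim: k => [|k IH] ys xs sy sx; first by rewrite !mulr0n /coef ffunE.
by rewrite !mulrS -IH // -sf // /coef ffunE.
Qed.

Lemma sem_sum2 m n (f : 'I_2 -> thom m n) F :
  (forall b, sem (f (bit b)) (F b)) ->
  sem (\sum_i f i) (fun ys xs => F false ys xs + F true ys xs).
Proof.
move=> sf; rewrite !big_ord_recl big_ord0 addr0 /=.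
apply: sem_add; first exact: (sf false).
by rewrite (_ : lift _ _ = bit true) //; apply/val_inj.
Qed.

Lemma sem_tens_family3 (L : 'I_3 -> 'M[K]_2) :
  sem (tens_family L) (fun ys xs =>
    let l i k := L i (bit (nth false ys k)) (bit (nth false xs k)) in
    l 0 0%N * l 1 1%N * l 2 2%N).
Proof.
move=> ys xs _ _; rewrite /coef ffunE /= !big_ord_recl big_ord0 !ffunE /= mulr1 mulrA.
by congr (L _ _ _ * L _ _ _ * L _ _ _); apply/val_inj.
Qed.

(* [w k] is the coefficient of the basis vectors with [k] ones, so that [binary_form N w] is a
   binary form with its binomial factors removed. *)
Definition binary_form N (w : nat -> K) : thom 0 N :=
  of_coef (fun y _ => w (\sum_i y i)%N).

Lemma binary_form_symmetric N w : symmetric_state (binary_form N w).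
Proof.
move=> s; apply/ffunP=> -[y x]; rewrite !ffunE /=.
rewrite (bigD1 [ffun i => y (s^-1%g i)]) //= big1 => [|z zy].
  rewrite !ffunE /= addr0.
  have -> : [ffun i => [ffun i0 => y ((s^-1)%g i0)] (s i)] = y.
    by apply/ffunP=> i; rewrite !ffunE permK.
  rewrite eqxx mul1r [in RHS](reindex_inj (@perm_inj _ s^-1%g)) /=.
  by congr w; apply: eq_bigr => i _; rewrite ffunE.
rewrite !ffunE /= (_ : _ == _ = false) ?mul0r //; apply: contraNF zy => /eqP ->.
by apply/eqP/ffunP=> i; rewrite !ffunE permKV.
Qed.

Lemma sem_binary_form N w : sem (binary_form N w) (fun s _ => w (count id s)).
Proof.
move=> s xs <- _; rewrite /coef ffunE /=; congr w.
elim: s => [|b s IH]; first by rewrite big_ord0.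
rewrite big_ord_recl ffunE /= -IH; congr (_ + _)%N; first by case: b.
by apply: eq_bigr => i _; rewrite !ffunE.
Qed.

Lemma symmetric_state_coef N (T : thom 0 N) (s : 'S_N) (y : {ffun 'I_N -> 'I_2}) x :
  symmetric_state T -> T ([ffun i => y (s i)], x) = T (y, x).
Proof.
move/(_ s)/ffunP/(_ ([ffun i => y (s i)], x)); rewrite ffunE /= => <-.
rewrite (bigD1 y) //= big1 => [|z zy]; rewrite ffunE /=; first by rewrite eqxx mul1r addr0.
rewrite (_ : _ == _ = false) ?mul0r //; apply: contraNF zy => /eqP/ffunP h.
by apply/eqP/ffunP=> i; have := h (s^-1%g i); rewrite !ffunE permKV.
Qed.

(** Two words with equally many ones are permutations of each other, so [w k] can be read off the
    word of [k] ones followed by zeros. *)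
Lemma symmetric_stateP N (T : thom 0 N) :
  symmetric_state T <-> exists w, T = binary_form N w.
Proof.
split=> [sT|[w ->]]; last exact: binary_form_symmetric.
exists (fun k => coef T (nseq k true ++ nseq (N - k) false) [::]).
apply/(sem_eqP (sem_coef _) (@sem_binary_form _ _)).
apply/all_wordsP=> s ss; apply/all_wordsP=> -[] // _.
set t := _ ++ _.
have pst : perm_eq t s.
  have st : size t = size s.
    by rewrite size_cat !size_nseq ss subnKC // -ss count_size.
  apply/allP=> b _ /=; rewrite -(rwP eqP).
  suff e1 : count id t = count id s.
    have c1 r : count_mem true r = count id r by apply: eq_count; case.
    have c0 r : count_mem false r = (size r - count id r)%N.
      by rewrite -(count_predC id r) addKn; apply: eq_count; case.
    by case: b; rewrite ?c1 ?c0 ?e1 ?st.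
  by rewrite count_cat !count_nseq mul1n mul0n addn0.
have st : size t == N by rewrite (perm_size pst) ss.
have ss' : size s == N by rewrite ss.
rewrite perm_sym in pst.
have /tuple_permP[p /= ep] : perm_eq (Tuple ss') (Tuple st) by [].
rewrite [LHS]/coef (_ : word N s = [ffun i => word N t (p i)]).
  by rewrite symmetric_state_coef.
apply/ffunP=> i; rewrite !ffunE ep; congr bit.
by rewrite (nth_map i) ?size_enum_ord // nth_ord_enum (tnth_nth false).
Qed.

End Coef.

(** * Tactics reducing tensor equations to coefficients *)

Ltac sem_step :=
  match goal with
  | |- sem (@tcomp _ _ _ _ _ _ _) _ => refine (sem_tcomp _ _)
  | |- sem (@tens _ _ ?m1 ?n1 ?m2 ?n2 ?f ?g) _ =>
      refine (@sem_tens _ m1 n1 m2 n2 f g _ _ _ _)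
  | |- sem (@idm _ _ ?n) _ => exact: (@sem_idm _ n)
  | |- sem (@ket _ _ _) _ => exact: sem_ket
  | |- sem (@bra _ _ _) _ => exact: sem_bra
  | |- sem swap _ => exact: sem_swap
  | |- sem (binary_form _ _) _ => exact: sem_binary_form
  | |- sem (_ + _) _ => refine (sem_add _ _)
  | |- sem (_ *+ _) _ => refine (sem_mulrn _)
  | |- sem (\sum_(_ < _) _) _ => refine (sem_sum2 _) => b
  | h : sem ?f _ |- sem ?f _ => exact: h
  end.

Ltac sem_solve := repeat sem_step.

(** The delta list leaves the field operations folded, as [ring] and [field] expect them. *)
Ltac words :=
  cbv beta iota zeta delta [all_words sum_words take drop cat addn Nat.add eqw negb andb
    nat_of_bool rev catrev count nth].

(** The continuation [Q] allows [F] and [G] to be left unknown until [sem_solve] fills them in from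
    the syntax of [f] and [g]. *)
Lemma sem_eq_elim {K : fieldType} m n (f g : thom K 2 m n) F G (Q : Prop) :
  f = g -> sem f F -> sem g G ->
  (all_words n (fun ys => all_words m (fun xs => F ys xs = G ys xs)) -> Q) -> Q.
Proof. by move=> e sf sg; apply; apply/(sem_eqP sf sg). Qed.

Ltac sem_elim e := refine (sem_eq_elim e _ _ _); [sem_solve|sem_solve|words].
Ltac sem_eq := eapply sem_eqP; [sem_solve|sem_solve|words].

(** * The effects of a Frobenius state *)

Section Effects.
Context {K : fieldType}.
Local Notation thom := (thom K 2).
Variable w : nat -> K.

Definition effect1 (x y : K) : thom 1 0 :=
  of_coef (fun _ v => if v ord0 == 0 then x else y).

Lemma sem_effect1 x y : sem (effect1 x y) (fun _ xs => if nth false xs 0 then y else x).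
Proof. by move=> [] // [|b []] // _ _; rewrite /coef ffunE /= ffunE; case: b. Qed.

Lemma effect1_onto (xi : thom 1 0) : exists x y, xi = effect1 x y.
Proof.
exists (coef xi [::] [:: false]), (coef xi [::] [:: true]).
by apply/(sem_eqP (@sem_coef _ _ _ _) (@sem_effect1 _ _)); words.
Qed.

Definition effect2 (P : bool -> bool -> K) : thom 2 0 :=
  of_coef (fun _ v => P (v ord0 == 1) (v ord_max == 1)).

Lemma sem_effect2 P : sem (effect2 P) (fun _ xs => P (nth false xs 0) (nth false xs 1)).
Proof.
by move=> [] // [|b [|c []]] // _ _; rewrite /coef ffunE /= !ffunE; case: b; case: c.
Qed.

Lemma effect2_onto (Phi : thom 2 0) : exists P, Phi = effect2 P.
Proof.
exists (fun b c => coef Phi [::] [:: b; c]).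
by apply/(sem_eqP (@sem_coef _ _ _ _) (@sem_effect2 _)); words.
Qed.

(** Determinant of the symmetric matrix of [(xi ⊗ 1 ⊗ 1) Psi]; as a quadratic form in [(x, y)] its
    discriminant is [disc w], defined below. *)
Definition slice_det (x y : K) : K :=
  (x * w 0 + y * w 1) * (x * w 2 + y * w 3) - (x * w 1 + y * w 2) ^+ 2.

(** The adjugate of the slice matrix divided by its determinant. *)
Definition cup_coef (x y : K) (b c : bool) : K :=
  match b, c with
  | false, false => x * w 2 + y * w 3
  | true, true => x * w 0 + y * w 1
  | _, _ => - (x * w 1 + y * w 2)
  end / slice_det x y.

Lemma effectsP (Phi : thom 2 0) (x y : K) :
  frobenius_effects (binary_form 3 w) Phi (effect1 x y) <->
  slice_det x y != 0 /\ Phi = effect2 (cup_coef x y).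
Proof.
have [P ->] := effect2_onto Phi.
have sP := sem_effect2 P; have sx := sem_effect1 x y.
split.
  rewrite /frobenius_effects; case=> e1 _.
  sem_elim e1 => -[[h00 h01] [h10 h11]].
  pose p := x * w 0 + y * w 1; pose q := x * w 1 + y * w 2; pose r := x * w 2 + y * w 3.
  have {}h00 : p * P false false + q * P true false = 1.
    by transitivity (1%:R : K) => //; rewrite -h00 /p /q; ring.
  have {}h01 : p * P false true + q * P true true = 0.
    by transitivity (0%:R : K) => //; rewrite -h01 /p /q; ring.
  have {}h10 : q * P false false + r * P true false = 0.
    by transitivity (0%:R : K) => //; rewrite -h10 /r /q; ring.
  have {}h11 : q * P false true + r * P true true = 1.
    by transitivity (1%:R : K) => //; rewrite -h11 /r /q; ring.
  have eD : slice_det x y = p * r - q ^+ 2 by [].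
  (* The four products in [h00] to [h11] form the identity matrix, so [slice_det x y] times the
     determinant of [P] is 1. *)
  have D0 : slice_det x y != 0.
    apply/eqP=> D0; have /eqP[] := oner_neq0 K.
    rewrite -[1]mulr1 -{1}h00 -h11.
    transitivity ((p * P false true + q * P true true) * (q * P false false + r * P true false)
      + slice_det x y * (P false false * P true true - P false true * P true false)).
      by rewrite eD; ring.
    by rewrite D0 h01 mul0r mul0r addr0.
  split=> //; have sc := sem_effect2 (cup_coef x y).
  apply/(sem_eqP sP sc); words; rewrite /cup_coef -/p -/q -/r.
  (* Cramer's rule, applied for each entry of [P] to the two equations of its column. *)
  split; split; apply: (canRL (mulfK D0)); rewrite eD.
  - transitivity (r * (p * P false false + q * P true false)
       - q * (q * P false false + r * P true false)); first by ring.
    by rewrite h00 h10; ring.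
  - transitivity (r * (p * P false true + q * P true true)
       - q * (q * P false true + r * P true true)); first by ring.
    by rewrite h01 h11; ring.
  - transitivity (p * (q * P false false + r * P true false)
       - q * (p * P false false + q * P true false)); first by ring.
    by rewrite h00 h10; ring.
  - transitivity (p * (q * P false true + r * P true true)
       - q * (p * P false true + q * P true true)); first by ring.
    by rewrite h01 h11; ring.
case=> D0 ->; have sc := sem_effect2 (cup_coef x y).
split.
  sem_eq.
  by rewrite /cup_coef; split; split; move: D0; rewrite /slice_det => D0; field.
(* The contraction depends only on the numbers [i] and [j] of ones in the first two and the last two
   factors, and equals [t i j]. Full symmetry amounts to [t i j = t j i] and [t 0 2 = t 1 1], so the
   balanced pair with [k./2 + uphalf k = k] can represent each weight [k]. *)
pose row i (u : bool) := w (i + u).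
pose t i j := \sum_(u : bool) \sum_(v : bool) row i u * cup_coef x y u v * row j v.
apply/symmetric_stateP; exists (fun k => t k./2 (uphalf k)).
sem_eq; rewrite /t /row /= !big_bool /= /cup_coef; words.
move: D0; rewrite /slice_det => D0; do ?split.
all: by field.
Qed.

End Effects.

(** * Structure constants and axioms of the induced algebra *)

Section InducedAlgebra.
Context {K : fieldType}.
Local Notation thom := (thom K 2).
Variables (w : nat -> K).

Definition sum_bit (F : bool -> K) : K := F false + F true.

Definition comul_coef (P : bool -> bool -> K) (j k i : bool) : K :=
  sum_bit (fun l => w (j + k + l)%N * P l i).

Definition mul_coef (P : bool -> bool -> K) (i j k : bool) : K :=
  sum_bit (fun l => comul_coef P i l j * P l k).

Variables (P : bool -> bool -> K) (xi : thom 1 0).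
Let A := induced_algebra (binary_form 3 w) (effect2 P) xi.

(** The coefficients generated by [sem_solve] are replaced by a closed form, which keeps later
    computations with the comultiplication small. *)
Lemma sem_fcomul :
  sem (fcomul A) (fun ys xs => comul_coef P (nth false ys 0) (nth false ys 1) (nth false xs 0)).
Proof.
have sP := sem_effect2 P.
have h : sem (fcomul A) (coef (fcomul A)) by exact: sem_coef.
refine (sem_eq_elim (erefl : fcomul A = _) h _ _).
  rewrite /A /=; sem_solve.
words => e; move=> [|i [|j []]] // [|k []] // _ _.
rewrite /comul_coef /sum_bit.
move: i j k => [] [] []; words; case: e => -[[e1 e2][e3 e4]] [[e5 e6][e7 e8]];
  rewrite ?(e1, e2, e3, e4, e5, e6, e7, e8); ring.
Qed.

Lemma sem_fmul :
  sem (fmul A) (fun ys xs => mul_coef P (nth false ys 0) (nth false xs 0) (nth false xs 1)).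
Proof.
have sP := sem_effect2 P; have sc := sem_fcomul.
have h : sem (fmul A) (coef (fmul A)) by exact: sem_coef.
refine (sem_eq_elim (erefl : fmul A = (idm 1 ⊗ effect2 P) ∘ (fcomul A ⊗ idm 1)) h _ _).
  sem_solve.
words => e; move=> [|k []] // [|i [|j []]] // _ _.
rewrite /mul_coef /sum_bit.
move: i j k => [] [] []; words; case: e => -[[e1 e2][e3 e4]] [[e5 e6][e7 e8]];
  rewrite ?(e1, e2, e3, e4, e5, e6, e7, e8); ring.
Qed.

End InducedAlgebra.

Section InducedCFA.
Context {K : fieldType}.
Variables (w : nat -> K) (x y : K).
Hypothesis D0 : slice_det w x y != 0.
Let A := induced_algebra (binary_form 3 w) (effect2 (cup_coef w x y)) (effect1 x y).

Lemma sem_funit :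
  sem (funit A) (fun ys _ =>
     let i := nth false ys 0 : nat in
     x ^+ 2 * w i + x * y * w i.+1 *+ 2 + y ^+ 2 * w i.+2).
Proof.
have sx := sem_effect1 x y.
have h : sem (funit A) (coef (funit A)) by exact: sem_coef.
refine (sem_eq_elim (erefl : funit A = _) h _ _).
  rewrite /A /=; sem_solve.
words => e; move=> [|i []] // [] // _ _.
by move: i => []; words; case: e => e1 e2; rewrite ?(e1, e2); ring.
Qed.

(** With explicit coefficients every axiom is a rational identity in [w 0], ..., [w 3], [x], [y]
    whose denominators are powers of [slice_det w x y]. *)
Lemma induced_CFA : is_CFA A.
Proof.
have sm : sem (fmul A) _ := @sem_fmul _ w _ _.
have sd : sem (fcomul A) _ := @sem_fcomul _ w _ _.
have su : sem (funit A) _ := sem_funit.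
have se : sem (fcounit A) _ := sem_effect1 x y.
(* [D0] in the unfolded form of the side conditions left by [field]. *)
have D1 : (x * w 0 + y * w 1) * (x * w 2 + y * w 3) - (x * w 1 + y * w 2) ^+ 2 != 0
  by exact: D0.
split; split; sem_eq;
  rewrite /mul_coef /comul_coef /sum_bit /cup_coef /slice_det; words; do ?split.
all: field; exact: D1.
Qed.

End InducedCFA.

(** * The handle, the partial traces and the discriminant *)

Section Handle.
Context {K : fieldType}.

(** Cayley's hyperdeterminant, written as the discriminant of the quadratic form
    [det (s p_0 + t p_1)] in [s] and [t], where [p_0] and [p_1] are the slices along the first
    index. *)
Definition hyperdet (p : bool -> bool -> bool -> K) : K :=
  (p false false false * p true true true + p true false false * p false true true
   - p false false true * p true true false - p false true false * p true false true) ^+ 2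
  - 4 * (p false false false * p false true true - p false false true * p false true false)
      * (p true false false * p true true true - p true false true * p true true false).

Definition disc (w : nat -> K) : K := hyperdet (fun i j k => w (i + j + k)%N).

Lemma discE w : disc w =
  (w 0 * w 3 - w 1 * w 2) ^+ 2 - 4 * (w 0 * w 2 - w 1 ^+ 2) * (w 1 * w 3 - w 2 ^+ 2).
Proof. by rewrite /disc /hyperdet; words; ring. Qed.

Variables (w : nat -> K) (x y : K).
Hypothesis D0 : slice_det w x y != 0.
Let A := induced_algebra (binary_form 3 w) (effect2 (cup_coef w x y)) (effect1 x y).

Definition handle_coef (i j : bool) : K :=
  sum_bit (fun k => sum_bit (fun l =>
    mul_coef w (cup_coef w x y) i k l * comul_coef w (cup_coef w x y) k l j)).

Lemma sem_handle :
  sem (fmul A ∘ fcomul A) (fun ys xs => handle_coef (nth false ys 0) (nth false xs 0)).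
Proof.
have sm : sem (fmul A) _ := @sem_fmul _ w _ _.
have sd : sem (fcomul A) _ := @sem_fcomul _ w _ _.
have h := sem_coef (fmul A ∘ fcomul A).
refine (sem_eq_elim (erefl : fmul A ∘ fcomul A = _) h _ _); first by sem_solve.
words => e; move=> [|i []] // [|j []] // _ _.
rewrite /handle_coef /sum_bit.
by move: i j => [] []; words; case: e => -[e1 e2] [e3 e4];
  rewrite ?(e1, e2, e3, e4); ring.
Qed.

Definition comul_trace_coef (i : bool) : K :=
  sum_bit (fun j => comul_coef w (cup_coef w x y) i j j).

Definition mul_trace_coef (k : bool) : K :=
  sum_bit (fun j => mul_coef w (cup_coef w x y) j k j).

Lemma sem_traces :
  sem (comul_trace (fcomul A) ∘ mul_trace (fmul A))
    (fun ys xs => comul_trace_coef (nth false ys 0) * mul_trace_coef (nth false xs 0)).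
Proof.
have sm : sem (fmul A) _ := @sem_fmul _ w _ _.
have sd : sem (fcomul A) _ := @sem_fcomul _ w _ _.
have h := sem_coef (comul_trace (fcomul A) ∘ mul_trace (fmul A)).
refine (sem_eq_elim (erefl : comul_trace (fcomul A) ∘ mul_trace (fmul A) = _) h _ _).
  by rewrite /comul_trace /mul_trace; sem_solve.
words => e; move=> [|i []] // [|j []] // _ _.
rewrite /comul_trace_coef /mul_trace_coef /sum_bit.
by move: i j => [] []; words; case: e => -[e1 e2] [e3 e4];
  rewrite ?(e1, e2, e3, e4); ring.
Qed.

(** The last two factors are the entries of [J xi] and [J eta], with [eta] the unit computed in
    [sem_funit]. *)
Lemma handle_traceE i j :
  handle_coef i j *+ 2 - comul_trace_coef i * mul_trace_coef j =
  disc w / slice_det w x y ^+ 3 *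
  (if i then - x else y) *
  (if j then - (x ^+ 2 * w 0 + x * y * w 1 *+ 2 + y ^+ 2 * w 2)
   else x ^+ 2 * w 1 + x * y * w 2 *+ 2 + y ^+ 2 * w 3).
Proof.
have D1 : (x * w 0 + y * w 1) * (x * w 2 + y * w 3) - (x * w 1 + y * w 2) ^+ 2 != 0
  by exact: D0.
rewrite /handle_coef /comul_trace_coef /mul_trace_coef /mul_coef /comul_coef /sum_bit
  /cup_coef discE /slice_det.
case: i; case: j; words; field; exact: D1.
Qed.

Lemma antispecialE : antispecial A <-> disc w = 0.
Proof.
have sh := sem_handle; have st := sem_traces; rewrite /antispecial.
have ht : fmul A ∘ fcomul A *+ 2 = comul_trace (fcomul A) ∘ mul_trace (fmul A) <->
    forall i j, handle_coef i j *+ 2 - comul_trace_coef i * mul_trace_coef j = 0.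
  rewrite (sem_eqP (@sem_mulrn _ _ _ _ 2 _ sh) st); words; split.
    by move=> -[[e00 e01] [e10 e11]] [] []; apply/eqP; rewrite subr_eq0; apply/eqP.
  by move=> z; do ?split; apply/eqP; rewrite -subr_eq0 z.
rewrite ht; split=> [[_ z]|d0]; last first.
  by split=> [|i j]; [exact: induced_CFA | rewrite handle_traceE d0 !mul0r].
apply/eqP/negPn/negP=> d0.
pose c := disc w / slice_det w x y ^+ 3.
have c0 : c != 0 by rewrite mulf_neq0 // invr_eq0 expf_neq0.
pose n0 := x ^+ 2 * w 0 + x * y * w 1 *+ 2 + y ^+ 2 * w 2.
pose n1 := x ^+ 2 * w 1 + x * y * w 2 *+ 2 + y ^+ 2 * w 3.
have {}z i j : (if i then - x else y) * (if j then - n0 else n1) = 0.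
  by apply: (mulfI c0); rewrite mulr0 mulrA -[RHS](z i j) handle_traceE.
(* [(n0, n1)] is the slice matrix applied to [(x, y)], so the adjugate turns it back into
   [slice_det w x y] times [(x, y)]. Hence [x] and [y] vanish, against [D0]. *)
have xD : (x * slice_det w x y) * x = 0.
  transitivity ((x * w 2 + y * w 3) * (- x * - n0) + (x * w 1 + y * w 2) * (- x * n1)).
    by rewrite /slice_det /n0 /n1; ring.
  by rewrite (z true true) (z true false) !mulr0 addr0.
have yD : (y * slice_det w x y) * y = 0.
  transitivity ((x * w 0 + y * w 1) * (y * n1) + (x * w 1 + y * w 2) * (y * - n0)).
    by rewrite /slice_det /n0 /n1; ring.
  by rewrite (z false true) (z false false) !mulr0 addr0.
move/eqP: xD; move/eqP: yD.
rewrite !mulf_eq0 (negPf D0) !orbF !orbb => /eqP y0 /eqP x0.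
by move: D0; rewrite /slice_det x0 y0 !mul0r !addr0 mul0r expr0n subrr eqxx.
Qed.

(** If the discriminant vanished, twice the identity would equal the rank-one map built from the two
    traces; the 2 by 2 determinant then gives a contradiction. *)
Lemma special_disc : 2 != 0 :> K -> special A -> disc w != 0.
Proof.
move=> two [_ e]; apply/eqP=> d0.
refine (sem_eq_elim e sem_handle (@sem_idm _ 1) _); words => -[[h00 h01] [h10 h11]].
have z i j : comul_trace_coef i * mul_trace_coef j = handle_coef i j *+ 2.
  by apply/esym/eqP; rewrite -subr_eq0 handle_traceE d0 !mul0r.
have : (comul_trace_coef false * mul_trace_coef false) *
         (comul_trace_coef true * mul_trace_coef true) =
       (comul_trace_coef false * mul_trace_coef true) *
         (comul_trace_coef true * mul_trace_coef false) by ring.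
rewrite !z h00 h11 h01 mul0rn mul0r => /eqP.
by rewrite mulf_eq0 orbb (negPf two).
Qed.

End Handle.

(** * Normal forms of binary cubics *)

Section Forms.
Context {K : fieldType}.

Definition sum_of_cubes (u0 u1 v0 v1 : K) (k : nat) : K :=
  match k with
  | 0 => u0 ^+ 3 + v0 ^+ 3
  | 1 => u0 ^+ 2 * u1 + v0 ^+ 2 * v1
  | 2 => u0 * u1 ^+ 2 + v0 * v1 ^+ 2
  | _ => u1 ^+ 3 + v1 ^+ 3
  end.

(* Coefficients of [e v v + v e v + v v e]. *)
Definition tangent_form (v0 v1 e0 e1 : K) (k : nat) : K :=
  match k with
  | 0 => e0 * v0 ^+ 2 *+ 3
  | 1 => e0 * v0 * v1 *+ 2 + e1 * v0 ^+ 2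
  | 2 => e1 * v0 * v1 *+ 2 + e0 * v1 ^+ 2
  | _ => e1 * v1 ^+ 2 *+ 3
  end.

Lemma binary_form_eq3 (w1 w2 : nat -> K) :
  w1 0%N = w2 0%N -> w1 1%N = w2 1%N -> w1 2%N = w2 2%N -> w1 3%N = w2 3%N ->
  binary_form 3 w1 = binary_form 3 w2.
Proof. by move=> e0 e1 e2 e3; sem_eq; rewrite e0 e1 e2 e3; do ?split. Qed.

End Forms.

Section NormalForms.
Context {K : numClosedFieldType}.
Variable w : nat -> K.

Lemma cube_root (s : K) : exists c, c ^+ 3 = s.
Proof. by exists (3.-root s); rewrite rootCK. Qed.

(* The Hessian covariant gives a linear recurrence for the coefficients. *)
Lemma disc_neq0_form : disc w != 0 ->
  exists u0 u1 v0 v1, u0 * v1 - u1 * v0 != 0 /\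
    binary_form 3 w = binary_form 3 (sum_of_cubes u0 u1 v0 v1).
Proof.
have two : 2 != 0 :> K by rewrite pnatr_eq0.
rewrite discE; set a := w 0 * w 2 - w 1 ^+ 2; set m := w 0 * w 3 - w 1 * w 2.
set c := w 1 * w 3 - w 2 ^+ 2 => d0.
have rec0 : c * w 0 - m * w 1 + a * w 2 = 0 by rewrite /a /m /c; ring.
have rec1 : c * w 1 - m * w 2 + a * w 3 = 0 by rewrite /a /m /c; ring.
have [a0|a0] := eqVneq a 0.
  (* One root of the recurrence is at infinity: [w 0], [w 1], [w 2] are geometric with ratio [r],
     and the second cube [(0, t)] corrects [w 3]. *)
  have m0 : m != 0 by apply: contraNneq d0 => ->; rewrite a0 mulr0 mul0r expr0n subrr.
  pose r := c / m.
  have w1 : w 1%N = r * w 0%N.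
    by apply: (mulfI m0); rewrite /r mulrA mulrCA mulfV // mulr1; move/eqP: rec0;
      rewrite a0 mul0r addr0 subr_eq0 => /eqP.
  have w2 : w 2%N = r * w 1%N.
    by apply: (mulfI m0); rewrite /r mulrA mulrCA mulfV // mulr1; move/eqP: rec1;
      rewrite a0 mul0r addr0 subr_eq0 => /eqP.
  have [s es] := cube_root (w 0%N); have [t et] := cube_root (w 3%N - r ^+ 3 * s ^+ 3).
  exists s, (r * s), 0, t; split.
    rewrite mulr0 subr0; apply: contraNneq m0 => st0; apply/eqP.
    have : s ^+ 3 * t ^+ 3 = 0 by rewrite -exprMn st0 expr0n.
    by rewrite et es => z; rewrite /m w2 w1 -[RHS]z; ring.
  by apply: binary_form_eq3; rewrite /sum_of_cubes ?w2 ?w1 -?es ?et ?expr0n /= -?es; ring.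
pose q := 2.-root (m ^+ 2 - 4 * a * c).
have q2 : q ^+ 2 = m ^+ 2 - 4 * a * c by rewrite rootCK.
have q0 : q != 0 by apply: contraNneq d0 => q0; rewrite -q2 q0 expr0n.
pose r1 := (m + q) / (2 * a); pose r2 := (m - q) / (2 * a).
have er1 : a * r1 ^+ 2 = m * r1 - c.
  apply: (mulfI (mulf_neq0 (mulf_neq0 two two) a0)).
  transitivity (m ^+ 2 + 2 * m * q + q ^+ 2); first by rewrite /r1; field; rewrite a0.
  by rewrite q2 /r1; field; rewrite a0.
have er2 : a * r2 ^+ 2 = m * r2 - c.
  apply: (mulfI (mulf_neq0 (mulf_neq0 two two) a0)).
  transitivity (m ^+ 2 - 2 * m * q + q ^+ 2); first by rewrite /r2; field; rewrite a0.
  by rewrite q2 /r2; field; rewrite a0.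
have r12 : r1 - r2 != 0.
  by rewrite (_ : r1 - r2 = q / a) ?mulf_neq0 ?invr_eq0 // /r1 /r2; field; rewrite a0.
(* [s ^+ 3] and [t ^+ 3] solve the Vandermonde system given by [w 0] and [w 1]; the recurrence then
   propagates the formula to [w 2] and [w 3]. *)
have [s es] := cube_root ((w 1%N - r2 * w 0%N) / (r1 - r2)).
have [t et] := cube_root ((r1 * w 0%N - w 1%N) / (r1 - r2)).
have w0 : w 0%N = s ^+ 3 + t ^+ 3 by rewrite es et; field.
have w1 : w 1%N = s ^+ 3 * r1 + t ^+ 3 * r2 by rewrite es et; field.
have w2 : w 2%N = s ^+ 3 * r1 ^+ 2 + t ^+ 3 * r2 ^+ 2.
  apply: (mulfI a0); transitivity (s ^+ 3 * (a * r1 ^+ 2) + t ^+ 3 * (a * r2 ^+ 2));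
    last by ring.
  transitivity (m * w 1%N - c * w 0%N + (c * w 0%N - m * w 1%N + a * w 2%N)); first by ring.
  by rewrite rec0 er1 er2 w1 w0; ring.
have w3 : w 3%N = s ^+ 3 * r1 ^+ 3 + t ^+ 3 * r2 ^+ 3.
  apply: (mulfI a0); transitivity (s ^+ 3 * (a * r1 ^+ 2) * r1 + t ^+ 3 * (a * r2 ^+ 2) * r2);
    last by ring.
  transitivity (m * w 2%N - c * w 1%N + (c * w 1%N - m * w 2%N + a * w 3%N)); first by ring.
  by rewrite rec1 er1 er2 w2 w1; ring.
exists s, (s * r1), t, (t * r2); split.
  (* [a] is a multiple of the squared determinant of the two vectors. *)
  apply: contraNneq a0 => z; apply/eqP.
  transitivity (s * t * (s * (t * r2) - s * r1 * t) ^+ 2); first by rewrite /a w0 w1 w2; ring.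
  by rewrite z expr0n mulr0.
by apply: binary_form_eq3; rewrite /sum_of_cubes ?w0 ?w1 ?w2 ?w3; ring.
Qed.

(** The characteristic polynomial of the same recurrence now has a double root, and the nonzero
    Hessian value keeps the recurrence nontrivial. *)
Lemma disc_eq0_form (x y : K) : disc w = 0 -> slice_det w x y != 0 ->
  exists v0 v1 e0 e1, v0 * e1 - v1 * e0 != 0 /\
    binary_form 3 w = binary_form 3 (tangent_form v0 v1 e0 e1).
Proof.
have two : 2 != 0 :> K by rewrite pnatr_eq0.
have three : 3 != 0 :> K by rewrite pnatr_eq0.
rewrite discE (_ : slice_det w x y = x ^+ 2 * (w 0 * w 2 - w 1 ^+ 2)
  + x * y * (w 0 * w 3 - w 1 * w 2) + y ^+ 2 * (w 1 * w 3 - w 2 ^+ 2)); last first.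
  by rewrite /slice_det; ring.
set a := w 0 * w 2 - w 1 ^+ 2; set m := w 0 * w 3 - w 1 * w 2.
set c := w 1 * w 3 - w 2 ^+ 2 => d0 D0.
have rec0 : c * w 0 - m * w 1 + a * w 2 = 0 by rewrite /a /m /c; ring.
have rec1 : c * w 1 - m * w 2 + a * w 3 = 0 by rewrite /a /m /c; ring.
have [a0|a0] := eqVneq a 0.
  (* The double root is at infinity, so [v] is [(0, 1)]. *)
  have m0 : m = 0 by move/eqP: d0; rewrite a0 mulr0 mul0r subr0 sqrf_eq0 => /eqP.
  have c0 : c != 0 by apply: contraNneq D0 => ->; rewrite a0 m0 !mulr0 !addr0.
  have w0 : w 0%N = 0.
    by apply: (mulfI c0); move: rec0; rewrite m0 a0 !mul0r subr0 addr0 mulr0.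
  have w1 : w 1%N = 0.
    by apply: (mulfI c0); move: rec1; rewrite m0 a0 !mul0r subr0 addr0 mulr0.
  exists 0, 1, (w 2%N), (w 3%N / 3); split.
    rewrite mul0r mul1r sub0r oppr_eq0; apply: contraNneq c0 => w2.
    by rewrite /c w1 w2 mul0r expr0n subrr.
  by apply: binary_form_eq3; rewrite /tangent_form ?w0 ?w1; field.
pose r := m / (2 * a).
have em : m = 2 * a * r by rewrite /r; field; rewrite a0.
have ec : c = a * r ^+ 2.
  apply: (mulfI (mulf_neq0 (mulf_neq0 two two) a0)); apply/esym.
  transitivity (m ^+ 2 - (m ^+ 2 - 4 * a * c)); last by ring.
  by rewrite d0 em; ring.
have w2 : w 2%N = 2 * r * w 1%N - r ^+ 2 * w 0%N.
  by apply: (mulfI a0); apply/eqP; rewrite -subr_eq0 -[X in _ == X]rec0 ec em; apply/eqP; ring.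
have w3 : w 3%N = 2 * r * w 2%N - r ^+ 2 * w 1%N.
  by apply: (mulfI a0); apply/eqP; rewrite -subr_eq0 -[X in _ == X]rec1 ec em; apply/eqP; ring.
(* The vector [e] is solved from [w 0 = 3 * e0] and [w 1 = 2 * r * e0 + e1]. *)
exists 1, r, (w 0%N / 3), (w 1%N - 2 * r * w 0%N / 3); split.
  apply: contraNneq a0 => z; apply/eqP.
  transitivity (- (1 * (w 1%N - 2 * r * w 0%N / 3) - r * (w 0%N / 3)) ^+ 2).
    by rewrite /a w2; field.
  by rewrite z expr0n oppr0.
by apply: binary_form_eq3; rewrite /tangent_form ?w3 ?w2; field.
Qed.

(** The vanishing Hessian coefficients make [w 0], ..., [w 3] a geometric progression, or leave only
    [w 3]. *)
Lemma hessian_eq0_form :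
  (forall x y, slice_det w x y = 0) ->
  exists s v0 v1, binary_form 3 w = binary_form 3 (fun k => s * v0 ^+ (3 - k) * v1 ^+ k).
Proof.
move=> D0.
have a0 : w 0 * w 2 = w 1 ^+ 2.
  by apply/eqP; rewrite -subr_eq0 -(D0 1 0) /slice_det; apply/eqP; ring.
have c0 : w 1 * w 3 = w 2 ^+ 2.
  by apply/eqP; rewrite -subr_eq0 -(D0 0 1) /slice_det; apply/eqP; ring.
have m0 : w 0 * w 3 = w 1 * w 2.
  apply/eqP; rewrite -subr_eq0; apply/eqP.
  (* Polarisation isolates the mixed coefficient of the quadratic form. *)
  transitivity (slice_det w 1 1 - slice_det w 1 0 - slice_det w 0 1).
    by rewrite /slice_det; ring.
  by rewrite !D0 !subr0.
have [w0|w0] := eqVneq (w 0%N) 0.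
  have w1 : w 1%N = 0 by apply/eqP; rewrite -sqrf_eq0 -a0 w0 mul0r.
  have w2 : w 2%N = 0 by apply/eqP; rewrite -sqrf_eq0 -c0 w1 mul0r.
  (* The convention [0 ^+ 0 = 1] makes the coefficient at [k = 3] equal to [w 3]. *)
  by exists (w 3%N), 0, 1; apply: binary_form_eq3; rewrite ?w0 ?w1 ?w2 /=; ring.
exists (w 0%N), 1, (w 1%N / w 0%N).
have w2 : w 2%N = w 1 ^+ 2 / w 0 by rewrite -a0; field.
have w3 : w 3%N = w 1 * w 2 / w 0 by rewrite -m0; field.
apply: binary_form_eq3; rewrite ?w3 ?w2 /=.
all: field => //.
Qed.

End NormalForms.

(** * SLOCC orbits of GHZ, W and product states *)

Section States.
Context {K : fieldType}.

Lemma sem_GHZ : sem (GHZ_state K) (fun ys _ =>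
  (eqw ys [:: false; false; false])%:R + (eqw ys [:: true; true; true])%:R).
Proof.
have s0 := @sem_ket K false; have s1 := @sem_ket K true.
refine (sem_eq_elim (erefl : GHZ_state K = _) (@sem_coef _ _ _ _) _ _).
  by rewrite /GHZ_state; sem_solve.
words => e [|i [|j [|k []]]] // [] // _ _.
by move: i j k e => [] [] [] [[[e1 e2] [e3 e4]] [[e5 e6] [e7 e8]]]; words;
  rewrite ?(e1, e2, e3, e4, e5, e6, e7, e8); ring.
Qed.

Lemma sem_W : sem (W_state K) (fun ys _ => (count id ys == 1)%:R).
Proof.
have s0 := @sem_ket K false; have s1 := @sem_ket K true.
refine (sem_eq_elim (erefl : W_state K = _) (@sem_coef _ _ _ _) _ _).
  by rewrite /W_state; sem_solve.
words => e [|i [|j [|k []]]] // [] // _ _.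
by move: i j k e => [] [] [] [[[e1 e2] [e3 e4]] [[e5 e6] [e7 e8]]];
  rewrite ?(e1, e2, e3, e4, e5, e6, e7, e8) /=; ring.
Qed.

Definition columns (u0 u1 v0 v1 : K) : 'M[K]_2 :=
  \matrix_(i, j) if j == 0 then (if i == 0 then u0 else u1)
                 else (if i == 0 then v0 else v1).

Lemma det2 (M : 'M[K]_2) : \det M = M (bit false) (bit false) * M (bit true) (bit true)
  - M (bit false) (bit true) * M (bit true) (bit false).
Proof.
rewrite (expand_det_row _ (bit false)) !big_ord_recl big_ord0 /cofactor !det_mx11 !mxE /= addr0.
rewrite expr0 expr1 mul1r mulN1r mulrN.
by congr (_ * M _ _ - M _ _ * M _ _); apply/val_inj.
Qed.

Lemma columnsE u0 u1 v0 v1 b c : columns u0 u1 v0 v1 (bit b) (bit c) =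
  if c then (if b then v1 else v0) else (if b then u1 else u0).
Proof. by rewrite mxE; case: b; case: c. Qed.

Lemma columns_unit u0 u1 v0 v1 : u0 * v1 - u1 * v0 != 0 -> columns u0 u1 v0 v1 \in unitmx.
Proof. by rewrite unitmxE unitfE det2 !columnsE [v0 * u1]mulrC. Qed.

Lemma GHZ_sum_of_cubes u0 u1 v0 v1 :
  binary_form 3 (sum_of_cubes u0 u1 v0 v1) =
  tens_family (fun=> columns u0 u1 v0 v1) ∘ GHZ_state K.
Proof.
have sg := sem_GHZ; have st := @sem_tens_family3 K (fun=> columns u0 u1 v0 v1).
sem_eq; rewrite !columnsE /sum_of_cubes /=; do ?split; ring.
Qed.

Lemma W_tangent_form v0 v1 e0 e1 :
  binary_form 3 (tangent_form v0 v1 e0 e1) =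
  tens_family (fun=> columns v0 v1 e0 e1) ∘ W_state K.
Proof.
have sg := sem_W; have st := @sem_tens_family3 K (fun=> columns v0 v1 e0 e1).
sem_eq; rewrite !columnsE /tangent_form /=; do ?split; ring.
Qed.

Lemma GHZ_neq0 : GHZ_state K != 0.
Proof.
apply/eqP=> /ffunP/(_ (word 3 [:: false; false; false], word 0 [::])).
rewrite [LHS]sem_GHZ //= ffunE addr0 => /eqP; exact/negP/oner_neq0.
Qed.

(** Local maps that kill [|1>] erase [|111>]; the scalar [s] is put into the first factor only. *)
Lemma GHZ_convertible_cube s v0 v1 :
  SLOCC_convertible (GHZ_state K) (binary_form 3 (fun k => s * v0 ^+ (3 - k) * v1 ^+ k)).
Proof.
pose L (i : 'I_3) := columns (if i == 0 then s * v0 else v0) (if i == 0 then s * v1 else v1) 0 0.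
exists L; have sg := sem_GHZ; have st := sem_tens_family3 L.
sem_eq; rewrite /L !columnsE /=; do ?split; ring.
Qed.

(** Local maps send product vectors to product vectors, whose coefficients satisfy
    [p000 * p111 = p001 * p110]; those of GHZ do not. *)
Lemma GHZ_not_equivalent_cube s v0 v1 :
  ~ SLOCC_equivalent (GHZ_state K) (binary_form 3 (fun k => s * v0 ^+ (3 - k) * v1 ^+ k)).
Proof.
case=> L _; have sg := sem_GHZ; have st := sem_tens_family3 L => e; sem_elim e.
set l0 := L 0; set l1 := L 1; set l2 := L 2.
pose p b0 b1 b2 := s * (l0 (bit b0) (bit false) * v0 + l0 (bit b0) (bit true) * v1)
  * (l1 (bit b1) (bit false) * v0 + l1 (bit b1) (bit true) * v1)
  * (l2 (bit b2) (bit false) * v0 + l2 (bit b2) (bit true) * v1).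
case=> -[[e0 e1] _] [_ [_ e7]].
have p0 : p false false false = 1 by rewrite -[RHS]addr0 [RHS]e0 /p /=; ring.
have p1 : p false false true = 0 by rewrite -[RHS]addr0 [RHS]e1 /p /=; ring.
have p7 : p true true true = 1 by rewrite -[RHS]add0r [RHS]e7 /p /=; ring.
have : p false false false * p true true true = p false false true * p true true false.
  by rewrite /p; ring.
by rewrite p0 p1 p7 mul0r mulr1; apply/eqP/oner_neq0.
Qed.

Lemma eq_hyperdet (p q : bool -> bool -> bool -> K) :
  (forall i j k, p i j k = q i j k) -> hyperdet p = hyperdet q.
Proof. by move=> e; rewrite /hyperdet !e. Qed.

(** Local maps multiply the hyperdeterminant by the square of the product of their determinants, and
    it equals 1 on GHZ. The three maps may differ, which is why [disc] is expressed through the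
    hyperdeterminant of a general tensor. *)
Lemma equivalent_GHZ_disc w : SLOCC_equivalent (binary_form 3 w) (GHZ_state K) -> disc w != 0.
Proof.
case=> L uL e; have sg := sem_GHZ; have st := sem_tens_family3 L.
have d0 i : \det (L i) != 0 by rewrite -unitfE -unitmxE.
rewrite (_ : disc w = (\det (L 0) * \det (L 1) * \det (L 2)) ^+ 2).
  by rewrite expf_neq0 // !mulf_neq0.
sem_elim e; case=> -[[e0 e1] [e2 e3]] [[e4 e5] [e6 e7]].
rewrite !det2; move: e0 e1 e2 e3 e4 e5 e6 e7.
set l0 := L 0; set l1 := L 1; set l2 := L 2 => e0 e1 e2 e3 e4 e5 e6 e7.
transitivity (hyperdet (fun b0 b1 b2 =>
    l0 (bit b0) (bit false) * l1 (bit b1) (bit false) * l2 (bit b2) (bit false) +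
    l0 (bit b0) (bit true) * l1 (bit b1) (bit true) * l2 (bit b2) (bit true))).
  apply: eq_hyperdet => -[] [] []; words; [rewrite e7|rewrite e6|rewrite e5|
      rewrite e4|rewrite e3|rewrite e2|rewrite e1|rewrite e0]; ring.
by rewrite /hyperdet; ring.
Qed.

(** The hyperdeterminant vanishes identically on the images of W under local maps. *)
Lemma equivalent_W_disc w : SLOCC_equivalent (binary_form 3 w) (W_state K) -> disc w = 0.
Proof.
case=> L _; have sg := sem_W; have st := sem_tens_family3 L => e; sem_elim e.
set l0 := L 0; set l1 := L 1; set l2 := L 2.
case=> -[[e0 e1] [e2 e3]] [[e4 e5] [e6 e7]].
transitivity (hyperdet (fun b0 b1 b2 =>
    l0 (bit b0) (bit true) * l1 (bit b1) (bit false) * l2 (bit b2) (bit false) +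
    l0 (bit b0) (bit false) * l1 (bit b1) (bit true) * l2 (bit b2) (bit false) +
    l0 (bit b0) (bit false) * l1 (bit b1) (bit false) * l2 (bit b2) (bit true))).
  apply: eq_hyperdet => -[] [] []; words; [rewrite e7|rewrite e6|rewrite e5|
      rewrite e4|rewrite e3|rewrite e2|rewrite e1|rewrite e0]; rewrite /=; ring.
by rewrite /hyperdet; ring.
Qed.

End States.

(** * Effects that make a sum of two cubes special *)

Section SpecialEffects.
Context {K : fieldType}.

(* For [Psi = u u u + v v v], the effect is the one sending [u] and [v] to 1, which makes
   [u] and [v] the copyable states of the induced algebra. *)
Lemma special_sum_of_cubes (u0 u1 v0 v1 : K) : u0 * v1 - u1 * v0 != 0 ->
  let w := sum_of_cubes u0 u1 v0 v1 in
  exists Phi xi, frobenius_effects (binary_form 3 w) Phi xi /\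
    special (induced_algebra (binary_form 3 w) Phi xi).
Proof.
move=> d0 w; set d := u0 * v1 - u1 * v0 in d0.
pose x := (v1 - u1) / d; pose y := (u0 - v0) / d.
(* The slice matrix at this effect is [u u^T + v v^T], the product of the matrix with columns [u],
   [v] and its transpose. *)
have eD : slice_det w x y = d ^+ 2.
  by rewrite /slice_det /w /= /x /y /d; field.
have D0 : slice_det w x y != 0 by rewrite eD expf_neq0.
exists (effect2 (cup_coef w x y)), (effect1 x y); split; first exact/effectsP.
split; first exact: induced_CFA.
apply/(sem_eqP (sem_handle _ _ _) (@sem_idm _ 1)); words.
rewrite /handle_coef /mul_coef /comul_coef /sum_bit /cup_coef eD; words.
have e0 : x * w 0%N + y * w 1%N = u0 ^+ 2 + v0 ^+ 2 by rewrite /w /= /x /y /d; field.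
have e1 : x * w 1%N + y * w 2%N = u0 * u1 + v0 * v1 by rewrite /w /= /x /y /d; field.
have e2 : x * w 2%N + y * w 3%N = u1 ^+ 2 + v1 ^+ 2 by rewrite /w /= /x /y /d; field.
rewrite e0 e1 e2 /w /sum_of_cubes /d in d0 *.
by do ?split; field.
Qed.

End SpecialEffects.

(** * Classification of maximal symmetric states *)

Lemma GHZ_special (K : numClosedFieldType) (w : nat -> K) : disc w != 0 ->
  SLOCC_equivalent (binary_form 3 w) (GHZ_state K) /\
  exists Phi xi, frobenius_effects (binary_form 3 w) Phi xi /\
    special (induced_algebra (binary_form 3 w) Phi xi).
Proof.
move=> /disc_neq0_form[u0 [u1 [v0 [v1 [d0 ->]]]]]; split; last exact: special_sum_of_cubes.
exists (fun=> columns u0 u1 v0 v1); last exact: GHZ_sum_of_cubes.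
by move=> _; exact: columns_unit.
Qed.

Lemma maximal_slice_det (K : numClosedFieldType) (w : nat -> K) :
  SLOCC_maximal (binary_form 3 w) -> exists x y, slice_det w x y != 0.
Proof.
move=> mw; apply: boolp.contrapT => noxy.
have [x y|s [v0 [v1 e]]] := @hessian_eq0_form _ w.
  by apply/eqP/negPn/negP=> D0; apply: noxy; exists x, y.
rewrite e in mw; apply: (@GHZ_not_equivalent_cube _ s v0 v1); apply: mw.
  exact: GHZ_neq0.
exact: GHZ_convertible_cube.
Qed.

Theorem theorem8p3p5 (R : realType) (Psi : thom R[i] 2 0 3) :
  Psi != 0 -> symmetric_state Psi -> SLOCC_maximal Psi ->
  [/\ frobenius_state Psi,
      SLOCC_equivalent Psi (GHZ_state R[i]) <->
        (exists (Phi : thom R[i] 2 2 0) (xi : thom R[i] 2 1 0),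
           frobenius_effects Psi Phi xi /\ special (induced_algebra Psi Phi xi))
    & forall (Phi : thom R[i] 2 2 0) (xi : thom R[i] 2 1 0),
        frobenius_effects Psi Phi xi ->
        (SLOCC_equivalent Psi (W_state R[i]) <->
           antispecial (induced_algebra Psi Phi xi))].
Proof.
move=> _ /symmetric_stateP[w ->] mw; split.
- split; first exact: binary_form_symmetric.
  have [x [y D0]] := maximal_slice_det mw.
  by exists (effect2 (cup_coef w x y)), (effect1 x y); apply/effectsP.
(* Both directions pass through [disc w != 0], from which [GHZ_special] yields the equivalence and
   the special effects together. *)
- split=> [/equivalent_GHZ_disc/GHZ_special[]//|[Phi [xi [+ sA]]]].
  have [x [y exi]] := effect1_onto xi; rewrite exi in sA * => /effectsP[D0 ePhi].
  rewrite ePhi in sA; have two : 2 != 0 :> R[i] by rewrite pnatr_eq0.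
  by have [] := GHZ_special (special_disc D0 two sA).
- move=> Phi xi; have [x [y ->]] := effect1_onto xi => /effectsP[D0 ->].
  rewrite antispecialE //; split=> [/equivalent_W_disc//|d0].
  have [v0 [v1 [e0 [e1 [ve0 ->]]]]] := disc_eq0_form d0 D0.
  exists (fun=> columns v0 v1 e0 e1); last exact: W_tangent_form.
  by move=> _; exact: columns_unit.
Qed.
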